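(* The function $S:(0,1)\to\mathbb{R}$ satisfies the initial value problem $$S''(x)=S(x)\,\bigl(S'(x)\bigr)^2\quad (0<x<1),\qquad S\left(\tfrac12\right)=0,\qquad S'\left(\tfrac12\right)=\sqrt{2\pi}.$$
   Context: $N:\mathbb{R}\to(0,1)$ is the cumulative standard normal probability function, $N(x)=\frac{1}{\sqrt{2\pi}}\int_{-\infty}^{x}e^{-t^2/2}\,dt$, and $S:(0,1)\to\mathbb{R}$ denotes its inverse, so $S(N(x))=x$ for $x\in\mathbb{R}$ and $N(S(x))=x$ for $x\in(0,1)$. *)

(* Defs.v *)
(* MathComp-Analysis *)
From mathcomp Require Import all_boot all_order all_algebra.
From mathcomp Require Import all_classical all_reals all_analysis.
Set Implicit Arguments.
Unset Strict Implicit.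
Unset Printing Implicit Defensive.
Import Order.TTheory GRing.Theory Num.Theory.
Import numFieldNormedType.Exports.
Local Open Scope classical_set_scope.
Local Open Scope ring_scope.

Definition std_normal_cdf (R : realType) (x : R) : R :=
  (Num.sqrt (2 * pi))^-1 *
  \int[lebesgue_measure]_(t in `]-oo, x]) expR (- t ^+ 2 / 2).

(* The inverse of [std_normal_cdf], whose range is the open interval ]0, 1[;
   it takes the irrelevant value 0 outside that range. *)
Definition std_normal_quantile (R : realType) : R -> R :=
  'pinv_(fun=> 0) setT (@std_normal_cdf R).

(* Main.v *)
Require Import Defs.
From HB Require Import structures.
From mathcomp Require Import all_boot all_order all_algebra.
From mathcomp Require Import all_classical all_reals all_analysis.
From mathcomp Require Import ring lra.
Set Implicit Arguments.
Unset Strict Implicit.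
Unset Printing Implicit Defensive.
Import Order.TTheory GRing.Theory Num.Theory.
Import numFieldNormedType.Exports.
Local Open Scope classical_set_scope.
Local Open Scope ring_scope.

(* With phi = N' the normal density, phi' = - x phi. Since phi > 0 and N tends
   to 0 and 1 at -oo and +oo, N is a bijection onto ]0, 1[, so S' = 1 / phi(S)
   there by the inverse function rule, and differentiating once more gives
   S'' = S phi(S) S' / phi(S) ^ 2 = S S' ^ 2. The initial value comes from
   N(x) + N(-x) = 1, which holds because the left-hand side has zero derivative
   and tends to 1 at +oo. *)

Section std_normal.
Context {R : realType}.
Implicit Types x y : R.

Local Notation mu := (@lebesgue_measure R).
Local Notation N := (@std_normal_cdf R).
Local Notation S := (@std_normal_quantile R).

Definition std_normal_density x : R :=
  (Num.sqrt (2 * pi))^-1 * expR (- x ^+ 2 / 2).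

Local Notation phi := std_normal_density.

(** Gives access to integrability, continuity and the probability measure of the normal law. *)
Lemma std_normal_densityE : phi = normal_pdf 0 1.
Proof.
apply/funext => x; rewrite normal_pdfE ?oner_neq0// /normal_peak /normal_fun.
by rewrite /phi expr1n mul1r subr0 mulr_natl.
Qed.

Lemma std_normal_density_gt0 x : 0 < phi x.
Proof.
by rewrite mulr_gt0 ?expR_gt0// invr_gt0 sqrtr_gt0 mulr_gt0 ?pi_gt0.
Qed.

Lemma std_normal_densityN x : phi (- x) = phi x.
Proof. by rewrite /phi sqrrN. Qed.

Lemma is_derive_std_normal_density x : is_derive x 1 phi (- x * phi x).
Proof.
have dsq : is_derive x 1 (fun y : R => - y ^+ 2 / 2) (- x).
  (* As a scalar multiple of a power, the exponent falls under the scaling and power rules. *)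
  rewrite (_ : (fun y : R => _) = - (2^-1 : R) \*: (fun y : R => y ^+ 2)).
    apply: is_derive_eq (is_deriveZ _ (is_deriveX 2 (is_derive_id x 1))) _.
    by rewrite /GRing.scale/=; field.
  by apply/funext => y /=; rewrite mulNr mulrC -mulNr.
have dphi := is_deriveZ (Num.sqrt (2 * pi))^-1
  (@is_derive1_comp _ expR (fun y : R => - y ^+ 2 / 2) _ _ _
    (is_derive_expR _) dsq).
by apply: is_derive_eq dphi _; rewrite /GRing.scale/= /phi; ring.
Qed.

Lemma integrable_std_normal_density (A : set R) : measurable A ->
  mu.-integrable A (EFin \o phi).
Proof.
move=> mA; rewrite std_normal_densityE; apply: (integrableS measurableT) => //.
exact: integrable_normal_pdf.
Qed.

Lemma std_normal_cdfE x : N x = \int[mu]_(t in `]-oo, x]) phi t.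
Proof.
have c0 : Num.sqrt (2 * pi) != 0 :> R.
  by rewrite gt_eqF// sqrtr_gt0 mulr_gt0// pi_gt0.
rewrite /std_normal_cdf -[RHS](mulKf c0).
rewrite -[X in _ = _ * X]RintegralZl//; last first.
  exact: integrable_std_normal_density.
by congr (_ * _); apply: eq_Rintegral => t _; rewrite /phi mulVKf.
Qed.

(** Seen as a random variable under [normal_prob 0 1], the identity has the standard normal law as
    its distribution, so the limits of a [cdf] at infinity carry over to [N]. *)
Let idTR : measurableTypeR R -> R := idfun.

#[local] HB.instance Definition _ :=
  @isMeasurableFun.Build _ _ _ _ idTR (@measurable_id _ _ setT).

Lemma std_normal_cdf_prob x :
  (N x)%:E = cdf (idTR : {RV (@normal_prob R 0 1) >-> R}) x.
Proof.
rewrite /cdf /distribution /pushforward preimage_id /= /normal_prob.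
rewrite -std_normal_densityE std_normal_cdfE /Rintegral fineK//.
by apply: integrable_fin_num => //; exact: integrable_std_normal_density.
Qed.

Lemma cvg_std_normal_cdfy : N @ +oo --> (1 : R).
Proof.
rewrite (_ : N =
  fun x => fine (cdf (idTR : {RV (@normal_prob R 0 1) >-> R}) x)).
  exact/fine_cvg/cvg_cdfy1.
by apply/funext => x; rewrite -std_normal_cdf_prob.
Qed.

Lemma cvg_std_normal_cdfNy : N @ -oo --> (0 : R).
Proof.
rewrite (_ : N =
  fun x => fine (cdf (idTR : {RV (@normal_prob R 0 1) >-> R}) x)).
  exact/fine_cvg/cvg_cdfNy0.
by apply/funext => x; rewrite -std_normal_cdf_prob.
Qed.

Lemma is_derive_std_normal_cdf x : is_derive x 1 N (phi x).
Proof.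
have cphi : {for x, continuous phi}.
  rewrite std_normal_densityE; apply: continuous_normal_pdf.
  by rewrite oner_neq0.
(* The fundamental theorem is applied at a point inside the integration range; any bound beyond [x]
   would do. *)
have xx1 : x < x + 1 by rewrite ltrDl.
have iphi : mu.-integrable `]-oo, x + 1] (EFin \o phi).
  exact: integrable_std_normal_density.
have [|dN eN] := continuous_FTC1 xx1 iphi _ cphi; first by rewrite ltNyr.
rewrite [N](_ : _ = (fun y => \int[mu]_(t in `]-oo, y]) phi t)); last first.
  by apply/funext => y; exact: std_normal_cdfE.
by apply: DeriveDef => //; rewrite -derive1E.
Qed.

Lemma continuous_std_normal_cdf : continuous N.
Proof.
move=> x; apply/differentiable_continuous/derivable1_diffP.
by have [] := is_derive_std_normal_cdf x.
Qed.

Lemma std_normal_cdf_incr : {homo N : x y / x < y}.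
Proof.
move=> x y xy.
apply: (@gtr0_derive1_incr _ N x y) => // [z _|z _|].
- by have [] := is_derive_std_normal_cdf z.
- rewrite derive1E; have [_ ->] := is_derive_std_normal_cdf z.
  exact: std_normal_density_gt0.
- exact/continuous_subspaceT/continuous_std_normal_cdf.
Qed.

Lemma std_normal_cdf_surj x : 0 < x < 1 -> exists y, N y = x.
Proof.
move=> /andP[x0 x1].
have [a Nax] : exists a, N a < x.
  have /cvgr_lt /(_ _ x0) := cvg_std_normal_cdfNy.
  move=> /(@filter_ex _ _ _ _); exact.
have [b xNb] : exists b, x < N b.
  have /cvgr_gt /(_ _ x1) := cvg_std_normal_cdfy.
  move=> /(@filter_ex _ _ _ _); exact.
(* If [b < a], monotonicity gives [N b < N a], against [N a < x < N b]. *)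
have [ab|ba] := leP a b; last first.
  by have := std_normal_cdf_incr ba; lra.
have Nab : N a <= N b by lra.
have [||c _ <-] := @IVT _ N a b x ab; last by exists c.
- exact/continuous_subspaceT/continuous_std_normal_cdf.
- by rewrite (min_idPl _)// (max_idPr _)// !ltW.
Qed.

Lemma std_normal_cdf0 : N 0 = 1 / 2.
Proof.
have NN x : N x + N (- x) = 1.
  have NN0 y : N y + N (- y) = N 0 + N (- 0).
    apply: (@is_derive_0_is_cst _ (N + (N \o -%R))) => z.
    have dNN : is_derive z 1 (N \o -%R) (phi z * -1).
      have dN : is_derive (- z) 1 N (phi z).
        by rewrite -std_normal_densityN; exact: is_derive_std_normal_cdf.
      exact: is_derive1_comp.
    have dN := is_derive_std_normal_cdf z.
    by apply: is_derive_eq; rewrite mulrN1 subrr.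
  have cvg1 : N y + N (- y) @[y --> +oo] --> (1 : R).
    rewrite -[X in _ --> X]addr0; apply: cvgD; first exact: cvg_std_normal_cdfy.
    exact: (iffLR (cvgNy_compNP N (nbhs (0 : R))) cvg_std_normal_cdfNy).
  (* A constant function tends to its own value, so uniqueness of limits identifies that value with
     1. *)
  have cvg0 : N y + N (- y) @[y --> +oo] --> N x + N (- x).
    by rewrite NN0; under eq_cvg do rewrite NN0; exact: cvg_cst.
  exact: cvg_unique cvg0 cvg1.
by have := NN 0; rewrite oppr0; lra.
Qed.

Lemma std_normal_cdfK : cancel N S.
Proof.
have Ninj : injective N.
  by apply: inc_inj; apply: le_mono; exact: std_normal_cdf_incr.
move=> x; apply: pinvKV; rewrite ?inE//.
by move=> ? ? _ _; exact: Ninj.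
Qed.

(** A left inverse is also a right inverse on the range, and every point of []0, 1[] is a value of
    [N]. *)
Lemma std_normal_quantileK x : 0 < x < 1 -> N (S x) = x.
Proof. by move=> /std_normal_cdf_surj[y <-]; rewrite std_normal_cdfK. Qed.

Lemma is_derive_std_normal_quantile x : 0 < x < 1 ->
  is_derive x 1 S (phi (S x))^-1.
Proof.
(* The inverse function rule differentiates at an image point, here [N (S x)]. *)
move=> x01; rewrite -[in X in is_derive X](std_normal_quantileK x01).
have NK : {near S x, cancel N S} by near=> y; exact: std_normal_cdfK.
have Ncont : {near S x, continuous N}.
  by near=> y; exact: continuous_std_normal_cdf.
apply: is_derive_inverse NK Ncont (is_derive_std_normal_cdf _) _.
by rewrite gt_eqF// std_normal_density_gt0.
Unshelve. all: by end_near.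
Qed.

Lemma is_derive1_std_normal_quantile x : 0 < x < 1 ->
  is_derive x 1 (derive1 S) (S x / phi (S x) ^+ 2).
Proof.
move=> x01.
have dS := is_derive_std_normal_quantile x01.
(* The formula for [derive1 S] is known only on []0, 1[]; this set being open, it holds near [x],
   which suffices. *)
apply: (@near_eq_is_derive _ _ _ (fun y => (phi (S y))^-1)).
  have x01i : x \in `]0, 1[ by rewrite in_itv.
  near=> y.
  have y01 : 0 < y < 1.
    have : y \in `]0, 1[ by near: y; exact: near_in_itvoo.
    by rewrite in_itv.
  rewrite derive1E.
  by have [_ ->] := is_derive_std_normal_quantile y01.
have phi0 : phi (S x) != 0 by rewrite gt_eqF// std_normal_density_gt0.
(* By the chain rule; the two factors in [phi (S x)] cancel to leave [- S x], whose sign is undone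
   by that of the reciprocal rule. *)
have dphi : is_derive x 1 (phi \o S) (- S x * phi (S x) * (phi (S x))^-1).
  exact: (is_derive1_comp (is_derive_std_normal_density (S x))).
apply: is_derive_eq (@is_deriveV _ (phi \o S) x _ _ phi0 dphi) _.
by rewrite /GRing.scale/= mulfK// mulrNN mulrC.
Unshelve. all: by end_near.
Qed.

End std_normal.

Theorem proposition2 (R : realType) :
  let S := @std_normal_quantile R in
  [/\ forall x : R, 0 < x < 1 ->
        [/\ derivable S x 1,
            derivable (derive1 S) x 1 &
            derive1n 2 S x = S x * (derive1 S x) ^+ 2],
      S (1 / 2) = 0 &
      derive1 S (1 / 2) = Num.sqrt (2 * pi)].
Proof.
have derS (x : R) : 0 < x < 1 ->
    derive1 (@std_normal_quantile R) x =
    (std_normal_density (@std_normal_quantile R x))^-1.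
  move=> x01; rewrite derive1E.
  by have [_ ->] := is_derive_std_normal_quantile x01.
have S12 : @std_normal_quantile R (1 / 2) = 0.
  by rewrite -std_normal_cdf0 std_normal_cdfK.
split => // [x x01|].
- have [dS _] := is_derive_std_normal_quantile x01.
  have [dS' eS'] := is_derive1_std_normal_quantile x01.
  split => //.
  by rewrite derive1nS derive1n1 derive1E eS' derS// exprVn.
- rewrite derS; last by lra.
  (* The exponential is 1 at 0, so the density there is its normalising constant, whose inverse is
     the claimed slope. *)
  by rewrite S12 /std_normal_density expr0n/= oppr0 mul0r expR0 mulr1 invrK.
Qed.
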